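(* Let $A$ be a reduced abelian $2$-group which is finitely integrable. Then: (1) only finitely many Ulm--Kaplansky invariants of $A$ are equal to $1$; (2) if $A$ has height $\tau>\omega$, then $f_\sigma(A)\neq 1$ for every ordinal $\sigma$ with $\omega\le\sigma<\tau$.
   Context: A group $A$ is finitely integrable if there exists a group $G$ such that $A\cong G'$ and $|G:G'|$ is finite, where $G'$ is the derived group (commutator subgroup) of $G$. Groups are written multiplicatively. A $2$-group (finite or infinite) is a group in which every element has order a power of $2$. An abelian $2$-group $A$ is divisible if $A^2=A$, and reduced if it contains no non-trivial divisible subgroup; here $A^2=\{x^2\mid x\in A\}$. For ordinals $\sigma$ define $A^{2^0}=A$, $A^{2^{\sigma+1}}=(A^{2^\sigma})^2$, and $A^{2^\sigma}=\bigcap_{\lambda<\sigma}A^{2^\lambda}$ for $\sigma$ a limit ordinal. If $A$ is reduced, its height is the smallest ordinal $\tau$ with $A^{2^\tau}=1$. Let $A[2]=\{x\in A\mid x^2=1\}$. For each ordinal $\sigma<\tau$ put \[U_\sigma(A)=\frac{A^{2^\sigma}\cap A[2]}{A^{2^{\sigma+1}}\cap A[2]},\] an elementary abelian $2$-group; the cardinal $f_\sigma(A)=\mathrm{rk}(U_\sigma(A))$ (its dimension over the field with $2$ elements) is the $\sigma$-th Ulm--Kaplansky invariant of $A$. Here $\omega$ is the first infinite ordinal. *)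

(* Defs.v *)
From HB Require Import structures.
From mathcomp Require Import all_boot all_order all_algebra.
From mathcomp Require Import mathcomp_extra boolp classical_sets functions.
From mathcomp Require Import cardinality.

Set Implicit Arguments.
Unset Strict Implicit.
Unset Printing Implicit Defensive.

Import Order.TTheory GRing.Theory.

Local Open Scope classical_set_scope.
Local Open Scope quotient_scope.
Local Open Scope card_scope.
Local Open Scope order_scope.

(* Ordinals. A tree [OSup f] denotes the least ordinal strictly above all     *)
(* the [f i]; every ordinal of a universe is denoted by some tree, and trees  *)
(* denoting the same ordinal are identified in the quotient [ordnum].         *)
Inductive otree : Type := OSup (I : Type) (f : I -> otree).

Fixpoint ole (t u : otree) {struct t} : Prop :=
  match t, u with OSup _ f, OSup _ g => forall i, exists j, ole (f i) (g j) end.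

Lemma ole_refl t : ole t t.
Proof. by elim: t => I f IH /= i; exists i. Qed.

Lemma ole_trans u t v : ole t u -> ole u v -> ole t v.
Proof.
elim: t u v => I f IH [J g] [K h] /= tu uv i.
have [j fg] := tu i; have [k gh] := uv j.
by exists k; apply: IH fg gh.
Qed.

Definition olt (t u : otree) : Prop :=
  match u with OSup _ g => exists j, ole t (g j) end.

Lemma ole_OSup I (f : I -> otree) u :
  ole (OSup f) u <-> forall i, olt (f i) u.
Proof. by case: u. Qed.

Lemma ole_lt_trans u t v : ole t u -> olt u v -> olt t v.
Proof. by case: v => K h tu [k uk]; exists k; apply: ole_trans uk. Qed.

Lemma olt_le_trans u t v : olt t u -> ole u v -> olt t v.
Proof.
case: u => J g [j tj] /ole_OSup/(_ j); exact: ole_lt_trans.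
Qed.

Lemma olt_le t u : olt t u -> ole t u.
Proof.
elim: t u => I f IH [J g] [j /ole_OSup tj]; apply/ole_OSup => i.
by exists j; apply/IH/tj.
Qed.

Lemma olt_irr t : ~ olt t t.
Proof.
by elim: t => I f IH [i /ole_OSup/(_ i)]; apply: IH.
Qed.

Lemma ole_or_lt t u : ole t u \/ olt u t.
Proof.
elim: t u => I f IH u.
have [H|/existsNP[i Hi]] := pselect (forall i, olt (f i) u).
  by left; apply/ole_OSup.
right; exists i; case: u Hi => J g Hi; apply/ole_OSup => j.
by have [H|//] := IH i (g j); case: Hi; exists j.
Qed.

Lemma olt_wf : well_founded olt.
Proof.
suff H u : forall t, ole t u -> Acc olt t by move=> t; apply: (H t); apply: ole_refl.
elim: u => J g IH t tu; constructor=> s st.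
have [j sj] := olt_le_trans st tu.
exact: (IH j).
Qed.

HB.instance Definition _ := gen_eqMixin otree.
HB.instance Definition _ := gen_choiceMixin otree.

Definition oeq (t u : otree) : bool := `[< ole t u >] && `[< ole u t >].

Lemma oeq_refl : reflexive oeq.
Proof. by move=> t; apply/andP; split; apply/asboolP; apply: ole_refl. Qed.

Lemma oeq_sym : symmetric oeq.
Proof. by move=> t u; rewrite /oeq andbC. Qed.

Lemma oeq_trans : transitive oeq.
Proof.
move=> u t v /andP[/asboolP tu /asboolP ut] /andP[/asboolP uv /asboolP vu].
by apply/andP; split; apply/asboolP; [apply: ole_trans uv|apply: ole_trans ut].
Qed.

Canonical oeq_equiv := EquivRel oeq oeq_refl oeq_sym oeq_trans.

Definition ordnum : Type := {eq_quot oeq_equiv}.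
HB.instance Definition _ := Choice.on ordnum.
HB.instance Definition _ := EqQuotient.on ordnum.

Definition ord_le (x y : ordnum) : bool := `[< ole (repr x) (repr y) >].

Lemma ord_le_refl : reflexive ord_le.
Proof. by move=> x; apply/asboolP; apply: ole_refl. Qed.

Lemma ord_le_anti : antisymmetric ord_le.
Proof.
move=> x y xy; rewrite -[x]reprK -[y]reprK.
by apply/eqmodP.
Qed.

Lemma ord_le_trans : transitive ord_le.
Proof.
by move=> y x z /asboolP xy /asboolP yz; apply/asboolP; apply: ole_trans yz.
Qed.

Lemma ord_le_total : total ord_le.
Proof.
move=> x y; have [|/olt_le] := ole_or_lt (repr x) (repr y) => H.
  by apply/orP; left; apply/asboolP.
by apply/orP; right; apply/asboolP.
Qed.

Fact ordnum_display : Order.disp_t. Proof. exact: Order.Disp tt tt. Qed.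

HB.instance Definition _ := Order.Le_isPOrder.Build ordnum_display ordnum
  ord_le_refl ord_le_anti ord_le_trans.
HB.instance Definition _ :=
  Order.POrder_isTotal.Build ordnum_display ordnum ord_le_total.

Lemma ole_repr_pi t : ole t (repr (\pi_ordnum t)) /\ ole (repr (\pi_ordnum t)) t.
Proof.
have /eqmodP/andP[/asboolP ? /asboolP ?] : t = repr (\pi_ordnum t) %[mod ordnum].
  by rewrite reprK.
by split.
Qed.

Lemma ord_lePi t u : reflect (ole t u) (\pi_ordnum t <= \pi_ordnum u).
Proof.
have [t1 t2] := ole_repr_pi t; have [u1 u2] := ole_repr_pi u.
apply: (iffP (asboolP _)) => H.
- exact: ole_trans t1 (ole_trans H u2).
- exact: ole_trans t2 (ole_trans H u1).
Qed.

Lemma ord_ltPi t u : reflect (olt t u) (\pi_ordnum t < \pi_ordnum u).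
Proof.
rewrite ltNge; apply: (iffP negP) => H.
  by have [ut|//] := ole_or_lt u t; case: H; apply/ord_lePi.
by move=> /ord_lePi ut; apply: (@olt_irr t); apply: olt_le_trans ut.
Qed.

Lemma ord_ltP (x y : ordnum) : reflect (olt (repr x) (repr y)) (x < y).
Proof. by rewrite -{2}[x]reprK -{2}[y]reprK; apply: ord_ltPi. Qed.

Lemma ord_lt_wf : well_founded (fun x y : ordnum => x < y).
Proof.
move=> x; move: {2}(repr x) (erefl (repr x)) => t.
elim/(well_founded_ind olt_wf): t x => t IH x xt; constructor=> y /ord_ltP yx.
by apply: IH (erefl _); rewrite -xt.
Qed.

Definition ord_zero : ordnum :=
  \pi_ordnum (@OSup Empty_set (fun e => match e with end)).

Definition osucc (t : otree) : otree := @OSup unit (fun=> t).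
Definition ord_succ (s : ordnum) : ordnum := \pi_ordnum (osucc (repr s)).

Definition ord_limit (s : ordnum) : Prop :=
  s <> ord_zero /\ forall l, s <> ord_succ l.

Definition ord_omega : ordnum :=
  \pi_ordnum (@OSup nat (fun n => iter n osucc (repr ord_zero))).

Lemma ord_zero_le (s : ordnum) : ord_zero <= s.
Proof. by rewrite -[s]reprK; apply/ord_lePi/ole_OSup; case. Qed.

Lemma ord_succ_le (s t : ordnum) : (ord_succ s <= t) = (s < t).
Proof.
rewrite -{1}[t]reprK; apply/ord_lePi/ord_ltP => [/ole_OSup/(_ tt)//|st].
by apply/ole_OSup.
Qed.

Lemma ord_lt_succ (s t : ordnum) : (s < ord_succ t) = (s <= t).
Proof. by rewrite !ltNge ord_succ_le ltNge negbK. Qed.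

Lemma ord_succ_inj : injective ord_succ.
Proof.
move=> s t E; apply/le_anti/andP; split.
- by rewrite -ord_lt_succ -E ord_lt_succ.
- by rewrite -ord_lt_succ E ord_lt_succ.
Qed.

Lemma ord_lt_succ_limit (s : ordnum) :
  ord_limit s -> forall l, l < s -> ord_succ l < s.
Proof.
move=> [_ sN] l ls; rewrite lt_neqAle ord_succ_le ls andbT.
by apply/eqP => E; apply: (sN l).
Qed.

Lemma ord_omega_limit : ord_limit ord_omega.
Proof.
have natP n : \pi_ordnum (iter n osucc (repr ord_zero)) < ord_omega.
  by apply/ord_ltPi; exists n; apply: ole_refl.
split=> [E|l E]; first by have := natP 0; rewrite E ltNge ord_zero_le.
have: l < ord_omega by rewrite E ord_lt_succ.
rewrite -{1}[l]reprK => /ord_ltPi[n ln].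
have := natP n.+1; rewrite E ord_lt_succ -[l]reprK => /ord_lePi nl.
have /ole_OSup/(_ tt) := ole_trans nl ln; exact: olt_irr.
Qed.

Lemma ord_omega_least (s : ordnum) : ord_limit s -> ord_omega <= s.
Proof.
move=> sl; suff H n : \pi_ordnum (iter n osucc (repr ord_zero)) < s.
  rewrite -[s]reprK; apply/ord_lePi; case E: (repr s) => [J g] n.
  by have := H n; rewrite -[s]reprK E => /ord_ltPi.
elim: n => [|n IHn].
  by rewrite /= reprK lt_neqAle ord_zero_le andbT; apply/eqP => E; case: sl; rewrite E.
apply: le_lt_trans (ord_lt_succ_limit sl IHn).
by apply/ord_lePi/ole_OSup => _; exists tt; case: (ole_repr_pi (iter n osucc (repr ord_zero))).
Qed.

Local Open Scope group_scope.

HB.mixin Record Group_isAbelian A of Group A := { mulgC : forall x y : A, x * y = y * x }.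
#[short(type="abelianGroupType")]
HB.structure Definition AbelianGroup := {A of Group_isAbelian A & Group A}.

Definition is_subgroup (G : groupType) (H : set G) : Prop :=
  H 1 /\ forall x y, H x -> H y -> H (x / y).

Definition derived (G : groupType) : set G :=
  smallest (@is_subgroup G) [set [~ x, y] | x in [set: G] & y in [set: G]].

Arguments derived : clear implicits.

Definition finite_index (G : groupType) (H : set G) : Prop :=
  finite_set (range (fun x : G => [set x * h | h in H])).

Definition finitely_integrable (A : groupType) : Prop :=
  exists (G : groupType) (phi : {multiplicative A -> G}),
    [/\ injective phi, range phi = derived G & finite_index (derived G)].

Definition has_order (G : groupType) (x : G) (n : nat) : Prop :=
  [/\ (0 < n)%N, x ^+ n = 1 & forall m, (0 < m)%N -> x ^+ m = 1 -> (n <= m)%N].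

Definition two_group (G : groupType) : Prop :=
  forall x : G, exists n, has_order x (2 ^ n).

Definition squares (G : groupType) (H : set G) : set G := [set x ^+ 2 | x in H].

Definition reduced (A : abelianGroupType) : Prop :=
  forall D : set A, is_subgroup D -> squares D = D -> D = [set 1].

(* [pow2 s] is the set A^(2^s).                                               *)
Inductive pow2 (A : groupType) : ordnum -> A -> Prop :=
| pow2_zero x : pow2 ord_zero x
| pow2_succ s x : pow2 s x -> pow2 (ord_succ s) (x ^+ 2)
| pow2_limit s x : ord_limit s -> (forall l, l < s -> pow2 l x) -> pow2 s x.

Section Pow2.
Variable A : groupType.

Lemma pow2_zeroE : pow2 ord_zero = [set: A].
Proof. by apply/seteqP; split => // x _; apply: pow2_zero. Qed.

Lemma ord_succ_neq0 s : ord_succ s <> ord_zero.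
Proof. by move=> E; have := ord_zero_le s; rewrite -ord_lt_succ E ltxx. Qed.

Lemma pow2_succE s : pow2 (ord_succ s) = squares (pow2 s) :> set A.
Proof.
apply/seteqP; split => [x|_ [x xs <-]]; last exact: pow2_succ.
move E: (ord_succ s) => t tx; case: tx E => [y /ord_succ_neq0//|r y yr /ord_succ_inj->|].
  by exists y.
by move=> r y [_ rl] _ E; case: (rl s).
Qed.

Lemma pow2_limitE s : ord_limit s ->
  pow2 s = \bigcap_(l in [set l | l < s]) pow2 l :> set A.
Proof.
move=> sl; apply/seteqP; split => [x|x H]; last exact: pow2_limit.
move=> sx; case: sx sl => [y [] //|r y _ [_ /(_ r)] //|r y _ H _]; exact: H.
Qed.

Lemma ord_ind3 (P : ordnum -> Prop) : P ord_zero ->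
  (forall s, P s -> P (ord_succ s)) ->
  (forall s, ord_limit s -> (forall l, l < s -> P l) -> P s) -> forall s, P s.
Proof.
move=> P0 PS Pl; apply: (well_founded_ind ord_lt_wf) => s IH.
have [->//|s0] := pselect (s = ord_zero).
have [[l sE]|sN] := pselect (exists l, s = ord_succ l).
  by rewrite sE; apply/PS/IH; rewrite sE ord_lt_succ.
by apply: Pl => //; split=> // l sE; apply: sN; exists l.
Qed.

End Pow2.

Definition is_height (A : groupType) (tau : ordnum) : Prop :=
  pow2 tau = [set 1 : A] /\
  forall s, pow2 s = [set 1 : A] -> tau <= s.

(* Additive copy of an abelian group, needed because the library's quotients  *)
(* and vector spaces are additive.                                            *)
Definition additive (A : abelianGroupType) : Type := A.

Section Additive.
Variable A : abelianGroupType.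

HB.instance Definition _ := Choice.on (additive A).
HB.instance Definition _ := GRing.isZmodule.Build (additive A)
  (@mulgA A) (@mulgC A) (@mul1g A) (@mulVg A).

Lemma is_subgroup_pow2 s : is_subgroup (pow2 s : set A).
Proof.
elim/ord_ind3: s => [|s [s1 sF]|s sl IH].
- by rewrite pow2_zeroE.
- rewrite pow2_succE; split; first by exists 1 => //; rewrite expg1n.
  move=> _ _ [x xs <-] [y ys <-]; exists (x / y); first exact: sF.
  by rewrite expgnFl //; apply: mulgC.
- rewrite pow2_limitE //; split=> [l /IH[]//|x y xs ys l ls].
  by have [_] := IH l ls; apply; [apply: xs|apply: ys].
Qed.

(* A^(2^s) :&: A[2]; the denominator of U_s(A) is this set at [ord_succ s]. *)
Definition pow2_socle (s : ordnum) : {pred additive A} :=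
  fun x => `[< pow2 s (x : A) /\ (x : A) ^+ 2 = 1 >].

Fact pow2_socle_zmod_closed s : zmod_closed (pow2_socle s).
Proof.
have [s1 sF] := is_subgroup_pow2 s; split.
  by apply/asboolP; split=> //; rewrite expg1n.
move=> x y /asboolP[xs x2] /asboolP[ys y2]; apply/asboolP; split.
  exact: sF.
rewrite -[(x - y)%R]/((x : A) / (y : A)) expgnFl; last exact: mulgC.
by rewrite x2 y2 divg1.
Qed.

HB.instance Definition _ s :=
  GRing.isZmodClosed.Build (additive A) (pow2_socle s) (pow2_socle_zmod_closed s).

Definition pow2_socle_type (s : ordnum) : Type :=
  {x : additive A | x \in pow2_socle s}.

HB.instance Definition _ s := SubChoice.on (pow2_socle_type s).
HB.instance Definition _ s := [SubChoice_isSubZmodule of pow2_socle_type s by <:].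

Definition pow2_socle_next (s : ordnum) : {pred pow2_socle_type s} :=
  fun u => val u \in pow2_socle (ord_succ s).

Fact pow2_socle_next_zmod_closed s : zmod_closed (@pow2_socle_next s).
Proof.
by split=> [|u v uP vP]; rewrite unfold_in /pow2_socle_next ?raddf0 ?raddfB ?rpred0 ?rpredB.
Qed.

HB.instance Definition _ s := GRing.isZmodClosed.Build (pow2_socle_type s)
  (@pow2_socle_next s) (@pow2_socle_next_zmod_closed s).

(* U_s(A), as a vector space over the field with two elements                 *)
Definition ulm_quotient (s : ordnum) : Type := 
  @Quotient.quot (pow2_socle_type s) (@pow2_socle_next s).

HB.instance Definition _ s := Choice.on (ulm_quotient s).
HB.instance Definition _ s := GRing.Zmodule.on (ulm_quotient s).


Lemma ulm_quotient_mulr2n s (x : ulm_quotient s) : (x *+ 2 = 0)%R.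
Proof.
rewrite -[x]reprK -raddfMn.
have -> : (repr x *+ 2 = 0)%R.
  apply: val_inj; rewrite raddfMn raddf0.
  by have /asboolP[] := valP (repr x).
exact: raddf0.
Qed.

Definition ulm_scale s (a : 'F_2) (x : ulm_quotient s) : ulm_quotient s :=
  (x *+ (a : nat))%R.

Lemma ulm_mulrn_mod s (x : ulm_quotient s) n : (x *+ (n %% 2)%N = x *+ n)%R.
Proof.
by rewrite {2}(divn_eq n 2) mulrnDr mulnC mulrnA ulm_quotient_mulr2n mul0rn add0r.
Qed.

Fact ulm_scaleA s a b (x : ulm_quotient s) :
  ulm_scale a (ulm_scale b x) = ulm_scale (a * b)%R x.
Proof. by rewrite /ulm_scale -mulrnA /= ulm_mulrn_mod mulnC. Qed.

Fact ulm_scale1 s : left_id 1%R (@ulm_scale s).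
Proof. by []. Qed.

Fact ulm_scaleDr s : right_distributive (@ulm_scale s) +%R.
Proof. by move=> a x y; rewrite /ulm_scale mulrnDl. Qed.

Fact ulm_scaleDl s (x : ulm_quotient s) :
  {morph (@ulm_scale s)^~ x : a b / (a + b)%R}.
Proof. by move=> a b; rewrite /ulm_scale /= ulm_mulrn_mod mulrnDr. Qed.

HB.instance Definition _ s := GRing.Zmodule_isLmodule.Build 'F_2 (ulm_quotient s)
  (@ulm_scaleA s) (@ulm_scale1 s) (@ulm_scaleDr s) (@ulm_scaleDl s).

End Additive.

Arguments ulm_quotient : clear implicits.

Definition is_basis (F : fieldType) (V : lmodType F) (B : set V) : Prop :=
  (forall (s : seq V) (c : V -> F), uniq s -> {in s, forall v, B v} ->
     (\sum_(v <- s) c v *: v = 0)%R -> {in s, forall v, c v = 0%R}) /\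
  (forall w : V, exists (s : seq V) (c : V -> F),
     {in s, forall v, B v} /\ w = (\sum_(v <- s) c v *: v)%R).

(* Cardinals are represented by sets up to [#=]: [has_dim V C] says that the  *)
(* dimension of [V] is the cardinality of [C].                                *)
Definition has_dim (F : fieldType) (V : lmodType F) T (C : set T) : Prop :=
  exists B : set V, is_basis B /\ B #= C.

(* [ulm_kaplansky A s C] says that the invariant f_s(A) is the cardinality    *)
(* of [C].                                                                    *)
Definition ulm_kaplansky (A : abelianGroupType) (s : ordnum) T (C : set T) : Prop :=
  has_dim (ulm_quotient A s) C.

Lemma height_exists (A : abelianGroupType) :
  reduced A -> exists tau, is_height A tau.
Proof.
move=> Ared.
have anti s t : s <= t -> pow2 t `<=` (pow2 s : set A).
  elim/ord_ind3: t s => [|t IH|t tl IH] s st.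
  - suff -> : s = ord_zero by [].
    by apply/le_anti/andP; split=> //; apply: ord_zero_le.
  - have [->//|sNt] := eqVneq s (ord_succ t).
    apply: subset_trans (IH s _); last by rewrite -ord_lt_succ lt_neqAle sNt.
    have [t1 tF] := is_subgroup_pow2 A t.
    rewrite pow2_succE => _ [x xt <-]; rewrite expg2 -[X in x * X]invgK -[x^-1]mul1g.
    by apply: (tF) => //; apply: tF.
  - have [->//|sNt] := eqVneq s t.
    by rewrite (pow2_limitE A tl) => x; apply; rewrite /= lt_neqAle sNt.
have [tau0 tauP] : exists t, pow2 t = [set 1 : A].
  have /choice[f fP] : forall x : A, exists s, ~ pow2 s x \/ forall t, pow2 t x.
    move=> x; have [H|/existsNP[s Hs]] := pselect (forall t, pow2 t x).
      by exists ord_zero; right.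
    by exists s; left.
  pose t := \pi_ordnum (@OSup A (fun x => repr (f x))).
  have tP (x : A) : pow2 t x -> forall s, pow2 s x.
    have [xN|//] := fP x; move=> xt; case: xN; apply: anti xt; apply/ltW.
    by rewrite -[f x]reprK; apply/ord_ltPi; exists x; apply: ole_refl.
  exists t; apply: Ared; first exact: is_subgroup_pow2.
  rewrite -pow2_succE; apply/seteqP; split=> x; last by move=> /tP; apply.
  by apply: anti; apply: ltW; rewrite ord_lt_succ.
have [tau [tau1 taumin]] : exists t, pow2 t = [set 1 : A] /\
    forall s, pow2 s = [set 1 : A] -> t <= s.
  elim/(well_founded_ind ord_lt_wf): tau0 tauP => t IH t1.
  have [[s [s1 st]]|tN] := pselect (exists s, pow2 s = [set 1 : A] /\ s < t).
    exact: IH st s1.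
  exists t; split=> // s s1; rewrite leNgt; apply/negP => st.
  by apply: tN; exists s.
by exists tau.
Qed.

(* Main.v *)
From HB Require Import structures.
Require Import Defs.
From mathcomp Require Import all_boot all_order all_algebra.
From mathcomp Require Import boolp classical_sets functions cardinality.

(** Let A = G' with G/A finite; since A is abelian, G acts on A by conjugation
    through the finite abelian group Q = G/A. Write A additively and let [A, Q]
    be the subgroup generated by the elements a.t - a.

    Modulo [A, Q], the commutator [t a, s b] with a, b in A depends only on the
    cosets t A and s A ([commutator_mod]). Hence A = G' is generated by [A, Q]
    and the finitely many commutators of a transversal, all of which are killed
    by some 2^e, so 2^e A = [2^e A, Q] ([derived_augmentation]).

    Let N be the product of norms over the odd parts of the elements of a
    transversal ([odd_norm]). On N(A) every element of Q acts with order a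
    power of 2, hence unipotently modulo 2. The subgroup D = 2^e N(A) satisfies
    D = [D, Q], and a unipotent action can satisfy this only if D = 2D
    ([unipotent_divisible]). As A is reduced, D = 0: N(A) is killed by 2^e
    ([odd_norm_bounded]).

    If the s-th invariant of A is 1, then Q acts trivially on the group U_s(A)
    of order 2, and so does N, because it is a product of sums of an odd number
    of automorphisms. Let u represent the non-zero element of U_s(A). If e <= s,
    then u = 2^e y for some y, so N u = 2^e (N y) = 0, whereas N u and u agree
    modulo A^(2^(s+1)): this contradicts the choice of u. So every s whose
    invariant is 1 satisfies s < e; there are finitely many of these, and all
    of them are below omega. *)

Set Implicit Arguments.
Unset Strict Implicit.
Unset Printing Implicit Defensive.

Import Order.TTheory GRing.Theory.
Local Open Scope classical_set_scope.
Local Open Scope order_scope.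

(** * Commuting operators on an abelian group *)

Lemma subrACA (V : zmodType) (a b c d : V) :
  ((a - b) - (c - d) = (a - c) - (b - d))%R.
Proof. by rewrite !opprD !opprK addrACA. Qed.

Section AdditiveSubgroups.
Local Open Scope ring_scope.
Variable V : zmodType.
Implicit Types (D M : set V).

Definition add_subgroup D : Prop := D 0 /\ forall x y, D x -> D y -> D (x - y).

Lemma add_subgroupN D : add_subgroup D -> forall x, D x -> D (- x).
Proof. by move=> [D0 DB] x Dx; rewrite -[- x]add0r; apply: DB. Qed.

Lemma add_subgroupD D : add_subgroup D -> forall x y, D x -> D y -> D (x + y).
Proof.
move=> Dg x y Dx Dy; rewrite -[y]opprK; have [_ DB] := Dg.
by apply: DB => //; apply: add_subgroupN.
Qed.

Lemma add_subgroupMn D : add_subgroup D -> forall n x, D x -> D (x *+ n).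
Proof.
move=> Dg; elim=> [|n IH] x Dx; first by rewrite mulr0n; case: Dg.
by rewrite mulrS; apply: add_subgroupD => //; apply: IH.
Qed.

Lemma add_subgroup0 : add_subgroup [set 0 : V].
Proof. by split=> // x y -> ->; rewrite subrr. Qed.

Lemma add_subgroup_image_mulrn n D :
  add_subgroup D -> add_subgroup [set x *+ n | x in D].
Proof.
move=> [D0 DB]; split; first by exists 0 => //; rewrite mul0rn.
by move=> _ _ [x Dx <-] [y Dy <-]; exists (x - y); [apply: DB|rewrite mulrnBl].
Qed.

End AdditiveSubgroups.

Section OperatorFamily.
Local Open Scope ring_scope.
Variables (T : eqType) (V : zmodType) (g : T -> {additive V -> V}).
Hypothesis gC : forall s t x, g s (g t x) = g t (g s x).
Implicit Types (D B M : set V) (f h : {additive V -> V}).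

(** B + [D, ts], where [D, ts] is the sum of the images of D under g t - 1 for t
    in ts. The recursion on ts allows the operators to be eliminated one at a
    time; when ts is a transversal of Q and the g t come from the action of Q,
    this is B + [D, Q]. *)
Fixpoint augmentation (ts : seq T) D B : set V :=
  if ts is t :: ts' then
    [set m + (g t y - y) | m in augmentation ts' D B & y in D]
  else B.

Lemma augmentation_subgroup ts D B :
  add_subgroup D -> add_subgroup B -> add_subgroup (augmentation ts D B).
Proof.
move=> [D0 DB] Bg; elim: ts => //= t ts [M0 MB]; split.
  by exists 0 => //; exists 0 => //; rewrite raddf0 subrr addr0.
move=> _ _ [m Mm [y Dy <-]] [m' Mm' [y' Dy' <-]].
exists (m - m'); first exact: MB; exists (y - y'); first exact: DB.
by rewrite raddfB subrACA [- (m' + _)]opprD addrACA.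
Qed.

Lemma augmentation_base ts D B : D 0 -> B `<=` augmentation ts D B.
Proof.
move=> D0; elim: ts => //= t ts IH x Bx; exists x; first exact: IH.
by exists 0 => //; rewrite raddf0 subrr addr0.
Qed.

Lemma augmentation_gen ts D B t y : add_subgroup D -> add_subgroup B ->
  t \in ts -> D y -> augmentation ts D B (g t y - y).
Proof.
move=> Dg Bg tts Dy; elim: ts tts => //= s ts IH.
rewrite in_cons => /orP[/eqP <-|tts].
  exists 0; first by have [] := augmentation_subgroup ts Dg Bg.
  by exists y; rewrite ?add0r.
exists (g t y - y); first exact: IH.
by exists 0; [case: Dg|rewrite raddf0 subrr addr0].
Qed.

Lemma augmentation_image f ts D B D' B' :
  (forall t x, f (g t x) = g t (f x)) ->
  (forall x, D x -> D' (f x)) -> (forall x, B x -> B' (f x)) ->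
  forall x, augmentation ts D B x -> augmentation ts D' B' (f x).
Proof.
move=> fC fD fB; elim: ts => //= t ts IH _ [m Mm [y Dy <-]].
exists (f m); first exact: IH; exists (f y); first exact: fD.
by rewrite raddfD raddfB fC.
Qed.

(** From D <= M + (h - 1) D one gets D <= M + (h - 1)^2 D, and (h - 1)^2 is
    h^2 - 1 modulo 2, so h can be replaced by h^2; after a steps h is the
    identity on D. *)
Lemma unipotent_absorb M D h a : add_subgroup M -> add_subgroup D ->
  (forall x, M x -> M (h x)) -> (forall x, D x -> D (h x)) ->
  (forall x, D x -> M (x *+ 2)) -> (forall x, D x -> iter (2 ^ a) h x = x) ->
  D `<=` [set m + (h y - y) | m in M & y in D] -> D `<=` M.
Proof.
move=> Mg Dg; elim: a h => [|a IH] h hM hD DM hx sub.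
  by move=> x /sub[m Mm [y Dy <-]]; rewrite (hx y Dy : h y = y) subrr addr0.
apply: (IH (h \o h)%FUN) => //=.
- by move=> x Mx; apply/hM/hM.
- by move=> x Dx; apply/hD/hD.
- move=> x Dx; rewrite -[RHS]hx // expnS mulnC iterM.
  exact: eq_iter.
move=> x /sub[m Mm [y /sub[m' Mm' [z Dz <-]] <-]].
(* The element is m + (h - 1) m' + (h - 1)^2 z, and
   (h - 1)^2 = (h^2 - 1) - 2 (h - 1). *)
exists (m + (h m' - m') - (h z - z) *+ 2).
  have [_ MB] := Mg; have [_ DB] := Dg.
  apply: (MB); last by apply/DM/DB => //; apply: hD.
  by apply: add_subgroupD => //; apply: (MB) => //; exact: (hM).
exists z => //=; set b := h z - z.
have -> : h (h z) - z = h b + b by rewrite raddfB addrA subrK.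
clearbody b; rewrite -addrA -addrA; congr (_ + _).
rewrite (raddfD h) [- (m' + b)]opprD [RHS]addrACA; congr (_ + _).
by rewrite mulr2n opprD addrC addrACA addrN addr0.
Qed.

(** Operators whose orders on D are powers of 2 are unipotent on D / 2D, so
    D = 2D + [D, ts] forces D = 2D: each operator is absorbed in turn into what
    the remaining ones generate together with 2D. *)
Lemma unipotent_divisible ts D : add_subgroup D ->
  (forall t x, D x -> D (g t x)) ->
  (forall t, t \in ts -> exists a, forall x, D x -> iter (2 ^ a) (g t) x = x) ->
  D `<=` augmentation ts D [set x *+ 2 | x in D] ->
  D `<=` [set x *+ 2 | x in D].
Proof.
move=> Dg gD; set D2 := [set x *+ 2 | x in D].
have D2g : add_subgroup D2 by apply: add_subgroup_image_mulrn.
elim: ts => //= t ts IH unip sub; apply: IH.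
  by move=> s sts; apply: unip; rewrite in_cons sts orbT.
have [a ga] := unip t (mem_head t ts).
apply: (unipotent_absorb _ Dg _ (gD t) _ ga sub).
- exact: augmentation_subgroup.
- apply: augmentation_image => // [x|_ [x Dx <-]]; first exact: gD.
  by exists (g t x); [apply: gD|rewrite raddfMn].
- by move=> x Dx; apply: augmentation_base; [case: Dg|exists x].
Qed.

Fact iter_is_zmod_morphism n f : zmod_morphism (iter n f).
Proof. by move=> x y; elim: n => //= n ->; rewrite raddfB. Qed.

HB.instance Definition _ n f :=
  GRing.isZmodMorphism.Build V V (iter n f) (iter_is_zmod_morphism n f).

Definition orbit_sum m f (x : V) : V := \sum_(i < m) iter i f x.

Fact orbit_sum_is_zmod_morphism m f : zmod_morphism (orbit_sum m f).
Proof.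
by move=> x y; rewrite /orbit_sum -sumrB; apply: eq_bigr => i _; rewrite raddfB.
Qed.

HB.instance Definition _ m f :=
  GRing.isZmodMorphism.Build V V (orbit_sum m f)
    (orbit_sum_is_zmod_morphism m f).

(** When f has order dividing m, the orbit sum is the norm of the cyclic group
    generated by f. *)
Lemma orbit_sum_fixed m f x :
  iter m f x = x -> f (orbit_sum m f x) = orbit_sum m f x.
Proof.
move=> fx; apply: (addrI x); rewrite raddf_sum /orbit_sum.
rewrite -[in LHS](big_ord_recl m (fun i : 'I_m.+1 => iter i f x)).
by rewrite big_ord_recr /= fx addrC.
Qed.

Lemma orbit_sum_comm m f h :
  (forall x, h (f x) = f (h x)) ->
  forall x, h (orbit_sum m f x) = orbit_sum m f (h x).
Proof.
move=> hf x; rewrite raddf_sum; apply: eq_bigr => i _.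
by elim: (val i) => //= n IH; rewrite hf IH.
Qed.

(** Modulo M the operator f fixes u, so the orbit sum of u is m u = u, as m is
    odd and u has order at most 2. *)
Lemma orbit_sum_congr m f M u : odd m -> add_subgroup M ->
  (forall x, M x -> M (f x)) -> M (f u - u) -> u *+ 2 = 0 ->
  M (orbit_sum m f u - u).
Proof.
move=> mo Mg fM fu u2.
have itM i : M (iter i f u - u).
  elim: i => [|i IH] /=; first by rewrite subrr; case: Mg.
  by rewrite -(subrKA (f u)) -raddfB; apply: add_subgroupD => //; apply: fM.
have um : u *+ m = u.
  by rewrite -(odd_double_half m) mo mulrS -mul2n mulrnA u2 mul0rn addr0.
rewrite -{2}um -[m in u *+ m]card_ord -sumr_const -sumrB.
elim/big_ind: _ => [|x y|i _]; [by case: Mg|exact: add_subgroupD|exact: itM].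
Qed.

Lemma orbit_sum_stable m f M : add_subgroup M ->
  (forall x, M x -> M (f x)) -> forall x, M x -> M (orbit_sum m f x).
Proof.
move=> Mg fM x Mx; rewrite /orbit_sum.
elim/big_ind: _ => [|y z|i _]; [by case: Mg|exact: add_subgroupD|].
by elim: (val i) => //= n; apply: fM.
Qed.

(** N is the composite, over t in ts, of the norms of the odd-order operators
    (g t)^(2^a), where 2^a is the 2-part of a period k of g t. The norm of each
    such operator has image in its fixed points, so (g t)^(2^a) fixes N x. *)
Lemma odd_norm (ts : seq T) :
  (forall t, t \in ts -> exists2 k, (0 < k)%N & forall x, iter k (g t) x = x) ->
  exists N : {additive V -> V},
    [/\ forall t x, N (g t x) = g t (N x),
        forall t, t \in ts ->
          exists a, forall x, iter (2 ^ a) (g t) (N x) = N x &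
        forall M u, add_subgroup M -> (forall t x, M x -> M (g t x)) ->
          (forall t, M (g t u - u)) -> u *+ 2 = 0 -> M (N u - u)].
Proof.
elim: ts => [|t ts IH] per.
  by exists idfun; split=> // M u [M0 _]; rewrite subrr.
have [|N [NC Nfix Ncongr]] := IH.
  by move=> s sts; apply: per; rewrite in_cons sts orbT.
have [k k0 gk] := per t (mem_head t ts).
have [m] := pfactor_coprime (isT : prime 2) k0.
rewrite coprime2n => mo kE; set a := logn 2 k in kE.
pose h : {additive V -> V} := iter (2 ^ a) (g t).
have hm x : iter m h x = x by rewrite -iterM -kE gk.
have gh s x : g s (h x) = h (g s x).
  by rewrite /h /=; elim: (2 ^ a)%N => //= n <-.
have hM M : (forall t x, M x -> M (g t x)) -> forall x, M x -> M (h x).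
  by move=> gM x; rewrite /h /=; elim: (2 ^ a)%N => //= n H /H; apply: gM.
exists (orbit_sum m h \o N)%FUN; split=> /=.
- by move=> s x; rewrite NC (orbit_sum_comm m (gh s)).
- move=> s; rewrite in_cons => /orP[/eqP ->|sts].
    by exists a => x; rewrite -/(h _) orbit_sum_fixed.
  have [b Nb] := Nfix s sts; exists b => x; rewrite -[in RHS]Nb.
  by elim: (2 ^ b)%N => //= n ->; rewrite (orbit_sum_comm m (gh s)).
- move=> M u Mg gM gu u2; rewrite -(subrKA (orbit_sum m h u)) -raddfB.
  apply: add_subgroupD => //.
    apply: orbit_sum_stable => //; first exact: hM.
    exact: Ncongr.
  apply: orbit_sum_congr => //; first exact: hM.
  rewrite /h /=; elim: (2 ^ a)%N => [|n IHn] /=.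
    by rewrite subrr; case: Mg.
  by rewrite -(subrKA (g t u)) -raddfB; apply: add_subgroupD => //; apply: gM.
Qed.

(** The hypothesis on augmentation says 2^e V = [2^e V, ts]. Applying N, the
    group 2^e N(V) equals its own augmentation and is therefore divisible. *)
Lemma odd_norm_bounded (ts : seq T) e :
  (forall D, add_subgroup D ->
     D `<=` [set x *+ 2 | x in D] -> D `<=` [set 0]) ->
  (forall t, t \in ts -> exists2 k, (0 < k)%N & forall x, iter k (g t) x = x) ->
  (forall x,
     augmentation ts [set y *+ 2 ^ e | y in [set: V]] [set 0] (x *+ 2 ^ e)) ->
  exists N : {additive V -> V},
    (forall x, N x *+ 2 ^ e = 0) /\
    forall M u, add_subgroup M -> (forall t x, M x -> M (g t x)) ->
      (forall t, M (g t u - u)) -> u *+ 2 = 0 -> M (N u - u).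
Proof.
move=> red per aug; have [N [NC Nfix Ncongr]] := odd_norm per.
exists N; split=> // x.
pose D := [set N z *+ 2 ^ e | z in [set: V]].
have Dg : add_subgroup D.
  split; first by exists 0 => //; rewrite raddf0 mul0rn.
  by move=> _ _ [y _ <-] [z _ <-]; exists (y - z); rewrite // raddfB mulrnBl.
suff D0 : D `<=` [set 0] by apply: D0; exists x.
apply: red => //; apply: (@unipotent_divisible ts) => //.
- by move=> t _ [z _ <-]; exists (g t z) => //; rewrite NC raddfMn.
- move=> t /Nfix[a Na]; exists a => _ [z _ <-].
  by rewrite -raddfMn Na.
- move=> _ [z _ <-]; rewrite -raddfMn.
  apply: augmentation_image (aug z) => // [_ [y _ <-]|_ ->].
    by exists y => //; rewrite raddfMn.
  by exists 0; [case: Dg|rewrite mul0rn raddf0].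
Qed.

End OperatorFamily.

(** * Ulm quotients of order two *)

Section OneDimensional.
Local Open Scope ring_scope.

Lemma dim1_gen (F : fieldType) (V : lmodType F) :
  has_dim V `I_1 -> exists2 b : V, b <> 0 & forall w, exists c : F, w = c *: b.
Proof.
move=> [B [[free gen]]] /eq_cardSP[b Bb].
rewrite II0 card_eq0 => /eqP B0.
have Beq v : B v -> v = b.
  move=> Bv; apply/eqP/negP => /negP/eqP vb.
  by have : (B `\ b) v by []; rewrite B0.
exists b => [b0|w].
  have /free : uniq [:: b] by [].
  move=> /(_ (fun=> 1)); rewrite big_seq1 b0 scaler0.
  move=> /(_ _ erefl b); rewrite -b0 mem_head => H.
  have : 1 = 0 :> F by apply: H => // v; rewrite inE => /eqP ->.
  by move/eqP; rewrite oner_eq0.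
have [s [c [sB ->]]] := gen w; exists (\sum_(v <- s) c v).
rewrite scaler_suml [LHS]big_seq [RHS]big_seq.
by apply: eq_bigr => v /sB/Beq ->.
Qed.

End OneDimensional.

Section UlmQuotient.
Local Open Scope quotient_scope.

(** A one-dimensional space over the field with two elements is {0, b}, and u
    lifts b. *)
Lemma ulm_kaplansky1 (A : abelianGroupType) s : ulm_kaplansky A s `I_1 ->
  exists u : A, [/\ pow2 s u, (u ^+ 2)%g = 1%g, ~ pow2 (ord_succ s) u &
    forall v, pow2 s v -> (v ^+ 2)%g = 1%g ->
      pow2 (ord_succ s) v \/ pow2 (ord_succ s) (v / u)%g].
Proof.
move=> /dim1_gen[b b0 gen].
have piP (v w : pow2_socle_type A s) :
    \pi_(ulm_quotient A s) v = \pi w <->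
    pow2 (ord_succ s) (val v / val w : A)%g.
  have -> : (\pi_(ulm_quotient A s) v = \pi w) <->
      (v - w)%R \in @pow2_socle_next A s.
    by rewrite Quotient.idealrBE; split=> [->|/eqP].
  split=> [/asboolP[]//|H]; apply/asboolP; split=> //.
  by have /asboolP[] := valP (v - w)%R.
pose w := repr b; have wb : b = \pi w by rewrite reprK.
have /asboolP[ws w2] := valP w.
have pi0 (v : pow2_socle_type A s) :
    \pi_(ulm_quotient A s) v = 0%R <-> pow2 (ord_succ s) (val v : A).
  rewrite -[X in _ = X](raddf0 (\pi_(ulm_quotient A s) : {additive _ -> _})) piP.
  by rewrite /= divg1.
exists (val w); split=> //; first by rewrite -pi0 -wb.
move=> v vs v2.
pose v' : pow2_socle_type A s :=
  exist _ (v : Defs.additive A) (asboolT (conj vs v2)).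
have [c] := gen (\pi v').
have [->|->] : c = 0%R \/ c = 1%R.
- by case: c => -[|[|]] // ?; [left|right]; apply: val_inj.
- by rewrite scale0r pi0; left.
- by rewrite scale1r wb piP; right.
Qed.

End UlmQuotient.

(** * The chain of iterated squares *)

Section Powers.
Variable A : groupType.
Local Open Scope group_scope.

Lemma pow2_sqr s (x : A) : pow2 s x -> pow2 s (x ^+ 2).
Proof.
elim/ord_ind3: s x => [|s IH|s sl IH] x.
- by move=> _; apply: pow2_zero.
- by rewrite pow2_succE => -[y ys <-]; exists (y ^+ 2) => //; apply: IH.
- by rewrite pow2_limitE // => xs l ls; apply: IH => //; apply: xs.
Qed.

Lemma pow2_anti s t : (s <= t)%O -> pow2 t `<=` (pow2 s : set A).
Proof.
elim/ord_ind3: t s => [|t IH|t tl IH] s st.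
- suff -> : s = ord_zero by [].
  by apply/le_anti/andP; split=> //; apply: ord_zero_le.
- have [->//|sNt] := eqVneq s (ord_succ t).
  rewrite pow2_succE => _ [x xt <-]; apply: pow2_sqr; apply: IH xt.
  by rewrite -ord_lt_succ lt_neqAle sNt.
- have [->//|sNt] := eqVneq s t.
  by rewrite (pow2_limitE A tl) => x; apply; rewrite /= lt_neqAle sNt.
Qed.

Lemma pow2_morph (f : A -> A) : {morph f : x y / x * y} ->
  forall s x, pow2 s x -> pow2 s (f x).
Proof.
move=> fM s x; elim=> {s x}[x|s x _ IH|s x sl _ IH].
- exact: pow2_zero.
- by rewrite expg2 fM -expg2; apply: pow2_succ.
- exact: pow2_limit.
Qed.

Definition ord_nat n := iter n ord_succ ord_zero.

Lemma pow2_natP n (x : A) : pow2 (ord_nat n) x -> exists y, x = y ^+ (2 ^ n).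
Proof.
elim: n x => [|n IH] x /=; first by exists x; rewrite expg1.
rewrite pow2_succE => -[y /IH[z ->] <-]; exists z.
by rewrite -expgnA expnSr.
Qed.

End Powers.

Lemma ord_nat_omega n : ord_nat n < ord_omega.
Proof.
elim: n => [|n IH] /=; last exact: ord_lt_succ_limit ord_omega_limit _ IH.
rewrite lt_neqAle ord_zero_le andbT; apply/eqP => E.
by case: ord_omega_limit => /(_ (esym E)).
Qed.

Lemma finite_ord_nat n : finite_set [set s | s < ord_nat n].
Proof.
elim: n => [|n IH].
  rewrite (_ : [set _ | _] = set0) // predeqE => s; split=> //=.
  by rewrite ltNge ord_zero_le.
have fin : finite_set ([set s | s < ord_nat n] `|` [set ord_nat n]).
  by rewrite finite_setU; split=> //; apply: finite_set1.
apply: sub_finite_set fin => s /=; rewrite ord_lt_succ le_eqVlt.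
by case/orP => [/eqP ->|]; [right|left].
Qed.

(** * The conjugation action on a finitely integrable group *)

Lemma finite_range_transversal (X Y : eqType) (f : X -> Y) :
  finite_set (range f) ->
  exists ts : seq X, forall x, exists2 t, t \in ts & f x = f t.
Proof.
move=> /finite_seqP[ys ysE].
have [ts tsE] : exists ts, map f ts = ys.
  have : {in ys, forall y, exists x, f x = y}.
    move=> y yys; have : range f y by rewrite ysE.
    by move=> [x _ <-]; exists x.
  elim: ys {ysE} => [|y ys IH] ysP; first by exists [::].
  have [x xy] := ysP y (mem_head y ys).
  have [|ts tsE] := IH; last by exists (x :: ts); rewrite /= xy tsE.
  by move=> z zys; apply: ysP; rewrite in_cons zys orbT.
exists ts => x; have : range f (f x) by exists x.
by rewrite ysE -tsE => /mapP[t tts ->]; exists t.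
Qed.

Lemma finite_set_collision (Y : Type) (F : set Y) (c : nat -> Y) :
  finite_set F -> (forall i, F (c i)) -> exists i j, (i < j)%N /\ c j = c i.
Proof.
move=> Ffin Fc; apply: contrapT => N; apply: infinite_nat.
have cI : injective c.
  move=> i j cE; case: (ltngtP i j) => // ij; case: N; first by exists i, j.
  by exists j, i.
have -> : [set: nat] = c @^-1` F
  by rewrite predeqE => i; split=> // _; apply: Fc.
by apply: finite_preimage Ffin => i j _ _; apply: cI.
Qed.

Section Integral.
Local Open Scope group_scope.
Variables (A : abelianGroupType) (G : groupType) (phi : {multiplicative A -> G}).
Hypotheses (phi_inj : injective phi) (phiG : range phi = derived G).
Hypothesis Gfin : finite_index (derived G).
Hypothesis A2 : two_group A.
Let V := Defs.additive A.

Lemma phiD (x y : V) : phi (x + y)%R = phi x * phi y.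
Proof. exact: (@gmulfM _ _ phi (x : A) (y : A)). Qed.

Lemma phi1 : phi 1 = 1.
Proof. by apply: (mulgI (phi 1)); rewrite -gmulfM !mulg1. Qed.

Lemma phiN (x : V) : phi (- x)%R = (phi x)^-1.
Proof.
by apply: (mulgI (phi x)); rewrite -phiD subrr mulgV [LHS]phi1.
Qed.

Lemma phiB (x y : V) : phi (x - y)%R = phi x / phi y.
Proof. by rewrite phiD phiN. Qed.

Lemma comm_img x y : exists c, phi c = [~ x, y].
Proof.
have : derived G [~ x, y] by apply: sub_gen_smallest; exists x => //; exists y.
by rewrite -phiG => -[c _ <-]; exists c.
Qed.

Lemma img_comm a b : phi a * phi b = phi b * phi a.
Proof. by rewrite -!gmulfM mulgC. Qed.

Lemma img_conj a b : phi a ^ phi b = phi a.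
Proof. by rewrite conjgE -img_comm mulKg. Qed.

Lemma conj_img t a : exists b, phi b = phi a ^ t.
Proof.
have [c cE] := comm_img (phi a) t; exists (a * c).
by rewrite gmulfM cE commgEl mulVKg.
Qed.

Lemma conj_action : exists g : G -> {additive V -> V},
  forall t (x : A), phi (g t x : A) = phi x ^ t.
Proof.
have /choice[g gE] : forall t, exists f : {additive V -> V},
    forall x : A, phi (f x : A) = phi x ^ t.
  move=> t; have /choice[f fE] := conj_img t.
  have fB : GRing.zmod_morphism (f : V -> V).
    move=> x y; apply: phi_inj; rewrite fE.
    by rewrite !phiB !fE conjMg conjVg.
  pose fA := GRing.isZmodMorphism.Build V V f fB.
  by exists (HB.pack_for {additive V -> V} (f : V -> V) fA).
by exists g.
Qed.

Variable g : G -> {additive V -> V}.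
Hypothesis gE : forall t (x : A), phi (g t x : A) = phi x ^ t.

(** [s, t] lies in the abelian group phi(A), so it centralizes phi(A). *)
Lemma conj_action_comm s t (x : V) : g s (g t x) = g t (g s x).
Proof.
apply: phi_inj; rewrite !gE -!conjgM (commgC t s).
have [c <-] := comm_img t s; rewrite conjgM.
by have [b <-] := conj_img (s * t) x; rewrite img_conj.
Qed.

Lemma iter_conj_action t k (x : V) :
  phi (iter k (g t) x : A) = phi (x : A) ^ (t ^+ k).
Proof.
by elim: k => [|k IH]; rewrite ?conjg1 //= gE IH -conjgM -expgSr.
Qed.

Lemma coset_img x y :
  [set x * h | h in derived G] = [set y * h | h in derived G] ->
  exists a, x = y * phi a.
Proof.
rewrite -phiG => E; have : [set x * h | h in range phi] x.
  by exists 1; rewrite ?mulg1 //; exists 1; rewrite ?phi1.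
by rewrite E => -[_ [a _ <-] <-]; exists a.
Qed.

(** Two powers of t lie in the same coset of G', so some positive power of t
    lies in G' and acts trivially on A. *)
Lemma conj_action_periodic t :
  exists2 k, (0 < k)%N & forall x : V, iter k (g t) x = x.
Proof.
pose c i := [set t ^+ i * h | h in derived G].
have [i [j [ij cij]]] : exists i j, (i < j)%N /\ c j = c i.
  by apply: finite_set_collision Gfin _ => i; exists (t ^+ i).
have [a tE] := coset_img cij; exists (j - i)%N; first by rewrite subn_gt0.
move=> x; apply: phi_inj; rewrite iter_conj_action.
suff -> : t ^+ (j - i) = phi a by rewrite img_conj.
by apply: (mulgI (t ^+ i)); rewrite -tE -expgnDr subnKC // ltnW.
Qed.

(** Elements of A act trivially on A, so in the commutator of t a and s b the
    entries a and b contribute separately, each through the other factor's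
    coset representative. *)
Lemma commutator_mod t s (a b c : V) : phi c = [~ t, s] ->
  [~ t * phi a, s * phi b] = phi (c + (g s a - a) - (g t b - b))%R.
Proof.
move=> cE; rewrite commgEl conjMg invgM.
have -> : t ^ (s * phi b) = t * phi (c - (g t b - b))%R.
  rewrite !phiB cE gE conjgM; rewrite (_ : t ^ s = t * [~ t, s]); last first.
    by rewrite commgEl mulVKg.
  rewrite -cE conjMg img_conj.
  rewrite invgF -gE -phiB -phiD [(c + _)%R]addrC [(b - _)%R]addrC.
  rewrite !phiD phiN gE !mulgA.
  by rewrite -conjVg !conjgE -!mulgA mulVKg.
have -> : phi a ^ (s * phi b) = phi (g s a) by rewrite conjgM -gE img_conj.
rewrite -!mulgA mulKg -phiN -!phiD; congr (phi _).
by rewrite addrCA [RHS]addrAC [(- a + _)%R]addrC.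
Qed.

Lemma mulrn_expg (x : V) n : (x *+ n)%R = (x : A) ^+ n.
Proof. by elim: n => //= n IH; rewrite mulrS expgS IH. Qed.

Lemma two_group_exponent (s : seq A) :
  exists e, forall x, x \in s -> x ^+ (2 ^ e) = 1.
Proof.
elim: s => [|y s [e eP]]; first by exists 0%N.
have [n [_ yn _]] := A2 y; exists (n + e)%N => x.
rewrite in_cons expnD => /orP[/eqP ->|/eP]; first by rewrite expgnA yn expg1n.
by rewrite mulnC expgnA => ->; rewrite expg1n.
Qed.

(** The exponent 2^e kills the commutators of pairs from a transversal, so the
    elements whose 2^e-multiple lies in [2^e A, ts] form a subgroup containing
    all commutators of G, hence all of G'. *)
Lemma derived_augmentation : exists (ts : seq G) e, forall x : V,
  augmentation g ts [set y *+ 2 ^ e | y in [set: V]]%R [set 0%R] (x *+ 2 ^ e)%R.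
Proof.
have [ts tsP] := finite_range_transversal Gfin.
have /choice[c cE] : forall p : G * G, exists c : V, phi c = [~ p.1, p.2].
  by move=> p; apply: comm_img.
have [e eP] :=
  two_group_exponent [seq c p | p <- [seq (t, s) | t <- ts, s <- ts]].
exists ts, e; set aug := augmentation _ _ _ _.
have Dg : add_subgroup [set (y : V) *+ 2 ^ e | y in [set: V]]%R.
  by apply: add_subgroup_image_mulrn; split.
have aug_g : add_subgroup aug.
  by apply: augmentation_subgroup => //; apply: add_subgroup0.
pose W := [set x : V | aug (x *+ 2 ^ e)%R].
have Wg : add_subgroup W.
  split; first by rewrite /W /= mul0rn; case: aug_g.
  by move=> x y Wx Wy; rewrite /W /= mulrnBl; case: aug_g => _; apply.
have dW : derived G `<=` [set phi (x : A) | x in W].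
  apply: smallest_sub.
    have [W0 WB] := Wg; split; first by exists 1; rewrite ?phi1.
    move=> _ _ [x Wx <-] [y Wy <-].
    by exists (x - y)%R; [apply: WB|rewrite phiB].
  move=> _ [x _ [y _ <-]].
  have [t tts /coset_img[a ->]] := tsP x.
  have [s sts /coset_img[b ->]] := tsP y.
  rewrite (commutator_mod a b (cE (t, s))).
  exists (c (t, s) + (g s (a : V) - (a : V)) - (g t (b : V) - (b : V)))%R => //.
  have Wgen r (z : V) : r \in ts -> W (g r z - z)%R.
    move=> rts; rewrite /W /= mulrnBl -raddfMn.
    by apply: (augmentation_gen _ Dg (add_subgroup0 V) rts); exists z.
  have [_ WB] := Wg; apply: (WB) (Wgen _ _ tts).
  apply: add_subgroupD => //; last exact: Wgen.
  rewrite /W /= mulrn_expg eP; first by case: aug_g.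
  by apply/map_f/allpairs_f.
move=> x; have : derived G (phi x) by rewrite -phiG; exists x.
by move=> /dW[y Wy /phi_inj <-].
Qed.

End Integral.

(** * Invariants equal to one *)

Theorem theorem5p10 (A : abelianGroupType) (tau : ordnum)
    (A2 : two_group A) (Ared : reduced A) (Aint : finitely_integrable A)
    (Atau : is_height A tau) :
  finite_set [set s : ordnum | s < tau /\ ulm_kaplansky A s `I_1]
  /\
  (ord_omega < tau ->
   forall s : ordnum, ord_omega <= s -> s < tau -> ~ ulm_kaplansky A s `I_1).
Proof.
suff [e small] : exists e, forall s, ulm_kaplansky A s `I_1 -> s < ord_nat e.
  split; first by apply: sub_finite_set (finite_ord_nat e) => s [_ /small].
  move=> _ s os _ /small; rewrite ltNge => /negP; apply.
  exact: le_trans (ltW (ord_nat_omega e)) os.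
have [G [phi [phi_inj phiG Gfin]]] := Aint.
have [g gE] := conj_action phi_inj phiG.
have [ts [e aug]] := derived_augmentation phi_inj phiG Gfin A2 gE.
have gC := conj_action_comm phi_inj phiG gE.
have per := conj_action_periodic phi_inj phiG Gfin gE.
have [|N [Ne Ncongr]] := odd_norm_bounded gC _ (fun t _ => per t) aug.
  move=> D Dg D2; have -> // : D = [set 0%R].
  apply: (Ared D Dg); apply/seteqP; split=> [_ [x Dx <-]|x /D2[y Dy <-]].
    by rewrite -mulrn_expg; apply: add_subgroupMn.
  by exists y => //; rewrite -mulrn_expg.
exists e => s /ulm_kaplansky1[u [us u2 uN uP]]; rewrite ltNge; apply/negP => es.
have [y uy] := pow2_natP (pow2_anti es us).
have Nu : N u = 0%R by rewrite uy -mulrn_expg raddfMn Ne.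
pose M : set (Defs.additive A) := pow2 (ord_succ s).
have Mg : add_subgroup M := is_subgroup_pow2 A (ord_succ s).
have gpow2 t r (x : A) : pow2 r x -> pow2 r (g t x : A).
  by apply: pow2_morph; apply: (raddfD (g t)).
suff : M (N u - (u : Defs.additive A))%R.
  by rewrite Nu sub0r => /(add_subgroupN Mg); rewrite opprK.
apply: Ncongr => // [t x|t]; first exact: gpow2.
(* If g t u were in M, then so would be u, an iterate of g t applied to it. *)
have [||Mgu|//] := uP (g t u : A); first exact: gpow2.
  by rewrite -mulrn_expg -raddfMn mulrn_expg u2 [LHS](raddf0 (g t)).
case: uN; have [[//|k] _ gk] := per t.
rewrite -[u]gk iterSr; elim: k {gk} => //= k; exact: gpow2.
Qed.
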